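(* Let $I$ be a compact interval, $f\colon I\to I$ a continuous map, $A\in\mathcal{C}(I)$, and suppose there are nondegenerate $B,C\in\mathrm{Per}(\tilde f)\cap s\alpha(A)$ such that $\mathcal{O}_f(B)\cap\mathcal{O}_f(C)=\emptyset$. Then $h_{top}(f)>0$.
   Context: $\mathcal{C}(I)$ is the space of nonempty subcontinua of $I$ (closed subintervals, including singletons) with the Hausdorff metric, and $\tilde f\colon\mathcal{C}(I)\to\mathcal{C}(I)$ is $\tilde f(A)=f(A)$. $\mathrm{Per}(\tilde f)$ is the set of periodic points of $\tilde f$, i.e. $B\in\mathcal{C}(I)$ with $f^p(B)=B$ for some $p>0$. Nondegenerate means containing more than one point. For $B\subset I$, $\mathcal{O}_f(B)=\bigcup_{n\ge0}f^n(B)\subset I$. A backward branch of $A\in\mathcal{C}(I)$ is a sequence $\{A_n\}_{n\le 0}$ in $\mathcal{C}(I)$ with $A_0=A$ and $f(A_n)=A_{n+1}$ for all $n<0$. The special $\alpha$-limit set $s\alpha(A)\subset\mathcal{C}(I)$ is the set of all $B\in\mathcal{C}(I)$ such that some backward branch $\{A_n\}_{n\le 0}$ of $A$ has a subsequence $A_{n_i}\to B$ with $n_i\to-\infty$. $h_{top}(f)$ denotes topological entropy. *)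

(* Defs.v *)
From HB Require Import structures.
From mathcomp Require Import all_boot all_order all_algebra finmap.
From mathcomp Require Import all_classical all_reals all_analysis.

Set Implicit Arguments.
Unset Strict Implicit.
Unset Printing Implicit Defensive.

Import Order.TTheory GRing.Theory Num.Theory.
Import numFieldNormedType.Exports.

Local Open Scope classical_set_scope.
Local Open Scope ring_scope.

(* C(I). *)
Definition subcontinua (R : realType) (I : set R) : set (set R) :=
  [set A | [/\ A !=set0, compact A, connected A & A `<=` I]].

(* Real-valued sup and inf: only meaningful for nonempty bounded A and B. *)
Definition hausdorff_dist (R : realType) (A B : set R) : R :=
  Num.max (sup [set inf [set `|x - y| | y in B] | x in A])
          (sup [set inf [set `|x - y| | x in A] | y in B]).

Definition nondegenerate_set (T : Type) (A : set T) : Prop :=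
  exists x y : T, [/\ A x, A y & x <> y].

Definition induced_map (T : Type) (f : T -> T) (A : set T) : set T := f @` A.

Definition induced_periodic (R : realType) (I : set R) (f : R -> R) :
    set (set R) :=
  [set B | subcontinua I B /\
           exists2 p : nat, (0 < p)%N & iter p (induced_map f) B = B].

Definition set_orbit (T : Type) (f : T -> T) (B : set T) : set T :=
  \bigcup_n iter n (induced_map f) B.

(* Indexed by nat: As n stands for A_{-n}. *)
Definition backward_branch (R : realType) (I : set R) (f : R -> R)
    (A : set R) (As : nat -> set R) : Prop :=
  [/\ forall n, subcontinua I (As n),
      As 0%N = A &
      forall n, induced_map f (As n.+1) = As n].

Definition special_alpha_limit (R : realType) (I : set R) (f : R -> R)
    (A : set R) : set (set R) :=
  [set B | subcontinua I B /\
    exists As : nat -> set R, backward_branch I f A As /\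
    exists2 k : nat -> nat, {homo k : i j / (i < j)%N} &
      hausdorff_dist (As (k i)) B @[i --> \oo] --> (0 : R)].

(* Topological entropy of f on I by Bowen's (n, e)-separated sets. *)
Definition bowen_separated (R : realType) (I : set R) (f : R -> R) (n : nat) (e : R)
    (E : {fset R}) : Prop :=
  [set` E] `<=` I /\
  forall x y : R, x \in E -> y \in E -> x != y ->
    exists2 k : nat, (k < n)%N & e < `|iter k f x - iter k f y|.

Definition separated_number (R : realType) (I : set R) (f : R -> R) (n : nat)
    (e : R) : \bar R :=
  ereal_sup [set (#|` E|%:R)%:E | E in bowen_separated I f n e].

(* The term n = 0 is junk and does not affect the limsup. *)
Definition entropy_at_scale (R : realType) (I : set R) (f : R -> R) (e : R) :
    \bar R :=
  limn_esup (fun n : nat => ((n%:R^-1)%:E * lne (separated_number I f n e))%E).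

Definition topological_entropy (R : realType) (I : set R) (f : R -> R) :
    \bar R :=
  lim (entropy_at_scale I f e @[e --> 0^'+]).

Lemma le_entropy_at_scale (R : realType) (I : set R) (f : R -> R) (e e' : R) :
  e <= e' -> (entropy_at_scale I f e' <= entropy_at_scale I f e)%E.
Proof.
move=> le_ee'; rewrite /entropy_at_scale !limn_esup_lim.
apply: lee_lim; [exact: is_cvg_esups|exact: is_cvg_esups|].
apply: nearW => m; apply: ge_ereal_sup => _ /= [n le_mn <-].
apply: (@le_trans _ _ ((n%:R^-1)%:E * lne (separated_number I f n e))%E);
  last by apply: ereal_sup_ubound; exists n.
have sep_ge0 d : (0 <= separated_number I f n d)%E.
  apply: ereal_sup_ubound; exists fset0; last by rewrite cardfs0.
  by split=> [x /= | x y]; rewrite in_fset0.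
apply: lee_wpmul2l; first by rewrite lee_fin invr_ge0 ler0n.
rewrite lee_lne ?in_itv/= ?sep_ge0 ?leey //.
apply: ereal_sup_le => _ [E [EI sepE] <-]; exists E => //; split=> // x y xE yE xy.
have [k kn kE] := sepE _ _ xE yE xy.
by exists k => //; exact: le_lt_trans kE.
Qed.

Lemma topological_entropyE (R : realType) (I : set R) (f : R -> R) :
  topological_entropy I f =
  ereal_sup [set entropy_at_scale I f e | e in `]0, +oo[].
Proof.
apply/cvg_lim => //; apply: (nonincreasing_at_right_cvge (BInfty _ false)) => //.
by move=> x y _ _; exact: le_entropy_at_scale.
Qed.

(* Main.v *)
Require Import Defs.
From mathcomp Require Import all_boot all_order all_algebra finmap.
From mathcomp Require Import all_classical all_reals all_analysis.
From mathcomp Require Import ring lra.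
Import Order.TTheory GRing.Theory Num.Theory.
Import numFieldNormedType.Exports.
Local Open Scope classical_set_scope.
Local Open Scope ring_scope.

(** Why two disjoint periodic orbits in the special alpha-limit set of [A]
    force positive entropy.

    Let [p] be a common period of [B] and [C], put [g = f^p], and call blocks
    the finitely many intervals [f^i(B)] and [f^i(C)] with [i < p]; each block is
    mapped to itself by [g], and a block of the orbit of [B] never meets a block
    of the orbit of [C].

    Since [B] is nondegenerate, an interval that is Hausdorff-close to [B] meets
    [B]; applied to the branch of [A] that accumulates at [B], this shows that
    [A] meets the orbit of [B], and likewise the orbit of [C]
    ([branch_limit_meets]).  Pulling back a point of [A] that lies in the orbit
    of [C] along the branch accumulating at [B] gives a backward orbit that
    starts in the orbit of [C] and accumulates at [B]; moving it forward by
    [f^i] along a suitable residue class of times mod [p] gives the same for [g]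
    and every block of the orbit of [B] ([limit_backward_orbit]).  By symmetry,
    every block is a repeller from which some [g]-orbits reach a block of the
    other kind: the blocks form a cycle of heteroclinic connections.

    A backward orbit that accumulates at a block [[l, r]] stays outside of it,
    so it accumulates at [l] from the left or at [r] from the right.  If its
    starting point is to the right of the block but it accumulates only at [l],
    it has to jump over the block, and then [g] already has a horseshoe
    ([faces_target_or_horseshoe]).  Otherwise every block sends points from its
    side facing the target onto the target.  The leftmost block has its target
    on the right and the rightmost one on the left, so there are a block with
    right end [r], target on the right, and a block with left end [l > r],
    target on the left, such that [[r, l]] lies between each of them and its
    target.  An iterate of [g] then stretches a short interval at [r] over
    [[r, l]], and another iterate stretches a short interval at [l] over
    [[r, l]] ([heteroclinic_horseshoe]).

    Finally a horseshoe gives positive entropy ([horseshoe_entropy]): with a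
    common iterate [T] of [f] that stretches two disjoint intervals over their
    hull, every itinerary of length [k] between the two intervals is realised,
    and points with distinct itineraries are separated by the gap. *)

(** * Horseshoes and entropy *)

Definition covers {R : realType} (F : R -> R) (c d p t : R) : Prop :=
  forall y, p <= y <= t -> exists2 z, c <= z <= d & F z = y.

(** The two intervals are disjoint, and each has an iterate of its own; a
    common iterate is found in [horseshoe_entropy]. *)
Definition horseshoe {R : realType} (a b : R) (f : R -> R) : Prop :=
  exists p q s t : R, exists n m : nat,
    [/\ a <= p /\ t <= b, p <= q /\ s <= t, q < s,
        covers (iter n f) p q p t & covers (iter m f) s t p t].

(** An interval that is stretched over a set containing it keeps covering that
    set under further iteration, so that covering times may be multiplied. *)
Lemma covers_iter {R : realType} {F : R -> R} {c d p t : R} k :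
  p <= c -> d <= t -> covers F c d p t ->
  covers (iter k.+1 F) c d p t.
Proof.
move=> pc dt cov; elim: k => [|k IH] y yH; first exact: cov.
have [z zcd zy] := cov y yH.
have [|w wcd wz] := IH z; first by apply/andP; split; lra.
by exists w => //; rewrite iterS wz.
Qed.

Lemma iter_iter (T : Type) (f : T -> T) n m x :
  iter m (iter n f) x = iter (m * n) f x.
Proof. by elim: m => //= m ->; rewrite mulSn iterD. Qed.

(** Realises itineraries: if [sel c] picks preimages under [F] of the points of
    [H], inside [H], then folding [sel] over a word [w] gives a point whose
    [i]-th iterate is obtained by folding the rest of [w], hence is of the form
    [sel c _] with [c] the [i]-th letter. *)
Lemma iter_foldr_preimage {T S : Type} {F : T -> T} {sel : S -> T -> T} {x0 : T}
    {H : T -> Prop} (Hx0 : H x0) :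
  (forall c y, H y -> H (sel c y) /\ F (sel c y) = y) ->
  forall w i, (i <= size w)%N ->
    H (foldr sel x0 w) /\ iter i F (foldr sel x0 w) = foldr sel x0 (drop i w).
Proof.
move=> selP; elim=> [|c w IH] i /=.
  by rewrite leqn0 => /eqP ->; split.
have Hw : H (foldr sel x0 w) by have [] := IH 0%N isT.
case: i => [|i] /=; first by move=> _; split => //; case: (selP c _ Hw).
rewrite ltnS => iw; split; first by case: (selP c _ Hw).
by rewrite -iterS iterSr (selP c _ Hw).2; case: (IH i iw).
Qed.

(** Sets of [2 ^ n] separated points at the times [N * n] make the growth rate
    at least [ln 2 / N] along a subsequence, and the entropy is a limsup. *)
Lemma entropy_gt0 {R : realType} (a b : R) (f : R -> R) (N : nat) (e : R) :
  (0 < N)%N -> 0 < e ->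
  (forall n : nat, exists2 E, bowen_separated `[a, b] f (N * n) e E
                            & #|` E| = (2 ^ n)%N) ->
  (0 < topological_entropy `[a, b] f)%E.
Proof.
move=> N0 e0 sepE.
rewrite topological_entropyE.
apply: (@lt_le_trans _ _ (entropy_at_scale `[a, b] f e)); last first.
  by apply: ereal_sup_ubound; exists e => //=; rewrite in_itv/= e0.
have NR0 : 0 < N%:R :> R by rewrite ltr0n.
apply: (@lt_le_trans _ _ (((N%:R)^-1 * ln 2)%:E)).
  by rewrite lte_fin mulr_gt0 ?invr_gt0// ln_gt0 // ltr1n.
rewrite /entropy_at_scale limn_esup_lim.
apply: lime_ge; first exact: is_cvg_esups.
apply: nearW => m; rewrite /esups.
apply: (@le_trans _ _ (((N * m.+1)%N%:R^-1)%:E *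
    lne (separated_number `[a, b] f (N * m.+1) e))%E); last first.
  apply: ereal_sup_ubound; exists (N * m.+1)%N => //=.
  by rewrite (leq_trans (leqnSn m)) // leq_pmull.
have [E sE cE] := sepE m.+1.
have Esep : (((2 ^ m.+1)%N%:R)%:E <= separated_number `[a, b] f (N * m.+1) e)%E.
  by apply: ereal_sup_ubound; exists E => //; rewrite cE.
apply: (@le_trans _ _ (((N * m.+1)%N%:R^-1)%:E * lne (((2 ^ m.+1)%N%:R : R)%:E))%E).
  rewrite lne_EFin ?ltr0n ?expn_gt0// -EFinM lee_fin natrX lnXn ?ltr0n//.
  rewrite natrM -mulr_natr le_eqVlt; apply/orP; left; apply/eqP; field.
  by rewrite nat1r (gt_eqF NR0) pnatr_eq0.
apply: lee_wpmul2l; first by rewrite lee_fin invr_ge0 ler0n.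
rewrite lee_lne ?in_itv/= ?leey ?andbT//.
exact: le_trans Esep.
Qed.

(** Both intervals cover the hull under [T = f^(m * n)].  Two words that differ
    at the [i]-th letter give points whose [i]-th iterates under [T] lie in
    different intervals, at distance at least [s - q]. *)
Lemma horseshoe_entropy (R : realType) (a b : R) (f : R -> R) :
  horseshoe a b f -> (0 < topological_entropy `[a, b] f)%E.
Proof.
move=> [p [q [s [t [n [m [[ap tb] [pq st] qs covJ covK]]]]]]].
(* Neither interval covers the hull by itself, so the covering times are positive. *)
have n0 : (0 < n)%N.
  case: n covJ => // /(_ t) [|z zpq /= zt]; first by apply/andP; split; lra.
  by lra.
have m0 : (0 < m)%N.
  case: m covK => // /(_ p) [|z zst /= zp]; first by apply/andP; split; lra.
  by lra.
pose T := iter (m * n) f.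
have TJ : covers T p q p t.
  move=> y yH; have [||z zpq zy] := covers_iter m.-1 _ _ covJ y yH; try lra.
  by exists z; rewrite // /T -zy prednK // iter_iter.
have TK : covers T s t p t.
  move=> y yH; have [||z zst zy] := covers_iter n.-1 _ _ covK y yH; try lra.
  by exists z; rewrite // /T -zy prednK // iter_iter mulnC.
have /choice [sel selP] (cy : bool * R) : exists z, p <= cy.2 <= t ->
    (if cy.1 then p <= z <= q else s <= z <= t) /\ T z = cy.2.
  case: cy => -[] y /=; case: (boolP (p <= y <= t)) => [yH|_]; try by exists 0.
    by have [z] := TJ y yH; exists z.
  by have [z] := TK y yH; exists z.
pose H y := p <= y <= t.
have Hp : H p by rewrite /H lexx/=; lra.
have selH c y : H y -> H (sel (c, y)) /\ T (sel (c, y)) = y.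
  move=> Hy; have [] := selP (c, y) Hy; rewrite /H.
  by case: c => /= ? ->; split => //; apply/andP; split; lra.
(* The point with itinerary [w]; the base point [p] is an arbitrary point of the hull. *)
pose pt w := foldr (fun c y => sel (c, y)) p w.
have ptP w i : (i <= size w)%N -> H (pt w) /\ iter i T (pt w) = pt (drop i w).
  by move=> iw; exact: (iter_foldr_preimage (sel := fun c y => sel (c, y)) Hp selH).
have pt_nth w i : (i < size w)%N ->
    if nth false w i then p <= iter i T (pt w) <= q else s <= iter i T (pt w) <= t.
  move=> iw; have [_ ->] := ptP w i (ltnW iw).
  rewrite (drop_nth false) //=.
  have [Hd _] := ptP (drop i.+1 w) 0%N isT.
  by have [] := selP (nth false w i, pt (drop i.+1 w)) Hd.
have far k (w w' : k.-tuple bool) : w != w' ->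
    exists2 i, (i < k)%N & (s - q) <= `|iter i T (pt w) - iter i T (pt w')|.
  move=> /eqP ww'; have [i /eqP wi] : exists i : 'I_k, tnth w i <> tnth w' i.
    by apply/existsNP => eqw; apply: ww'; exact: eq_from_tnth.
  exists i => //; move: wi.
  have := pt_nth w i; have := pt_nth w' i; rewrite !size_tuple ltn_ord.
  move=> /(_ isT) h' /(_ isT) h; rewrite !(tnth_nth false).
  move: h h'; case: nth; case: nth => //= h h' _.
    by rewrite distrC ger0_norm; lra.
  by rewrite ger0_norm; lra.
apply: (entropy_gt0 _ _ _ (m * n) ((s - q) / 2)); [by rewrite muln_gt0 m0|lra|].
move=> k; exists [fset pt (tval w) | w in {: k.-tuple bool}]%fset.
  split=> [x /= /imfsetP [w _ ->]|x y /imfsetP [w _ ->] /imfsetP [w' _ ->] neq].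
    have [/andP[h1 h2] _] := ptP w 0%N isT.
    by rewrite in_itv/=; apply/andP; split; lra.
  have /far [i ik far_i] : w != w' by apply: contraNN neq => /eqP ->.
  exists (i * (m * n))%N; first by rewrite mulnC ltn_pmul2l // muln_gt0 m0.
  by rewrite -!iter_iter -/T; lra.
rewrite card_imfset /=; last first.
  move=> w w' eqp; apply/eqP; apply: contraT => /far [i _].
  by rewrite eqp subrr normr0; lra.
by rewrite -cardE card_tuple card_bool.
Qed.

(** * Continuity and reflection on an interval *)

Definition maps_itv {R : realType} (a b : R) (g : R -> R) : Prop :=
  forall x, a <= x <= b -> a <= g x <= b.

(** The epsilon-delta form passes to subintervals, iterates and reflections
    without any manipulation of subspace topologies. *)
Definition unif_cont_on {R : realType} (a b : R) (g : R -> R) : Prop :=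
  forall e : R, 0 < e -> exists2 d : R, 0 < d &
    forall x y : R, a <= x <= b -> a <= y <= b -> `|x - y| < d -> `|g x - g y| < e.

Lemma within_unif_cont_on {R : realType} {a b : R} {g : R -> R} :
  {within `[a, b], continuous g} -> unif_cont_on a b g.
Proof.
move=> /subspace_continuousP gc e e0.
have /compact_near_coveringP cov := @segment_compact R a b.
have := cov R (0 : R)^'+ (fun d x => a <= x <= b -> forall y : R, a <= y <= b ->
  `|x - y| < d -> `|g x - g y| < e) _.
have loc (x : R) : a <= x <= b -> exists2 r : R, 0 < r &
    forall y : R, a <= y <= b -> `|x - y| < r -> `|g x - g y| < e / 2.
  move=> xab; have e20 : 0 < e / 2 by lra.
  have /(_ xab) := gc x; move=> /cvgrPdist_lt /(_ _ e20).
  rewrite near_withinE => -[/= r r0 hr].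
  by exists r => // y yab xy; apply: hr.
case.
  move=> x /loc [r r0 hr].
  exists ([set x' | `|x - x'| < r / 2], [set d | 0 < d < r / 2]) => /=.
    split; first by exists (r / 2) => //=; lra.
    exists (r / 2) => /=; first lra.
    by move=> y /=; rewrite sub0r normrN => + y0; rewrite gtr0_norm// y0 => ->.
  move=> [x' d] /= [h1 /andP[d0 h2]] x'ab y yab h3.
  have hx' : `|g x - g x'| < e / 2 by apply: hr => //; lra.
  have hy : `|g x - g y| < e / 2.
    apply: hr => //; apply: le_lt_trans (ler_distD x' x y) _.
    by rewrite (splitr r) ltrD// (lt_trans h3).
  apply: le_lt_trans (ler_distD (g x) (g x') (g y)) _.
  by rewrite (splitr e) ltrD// distrC.
move=> r /= r0 hr; exists (r / 2); first lra.
move=> x y xab yab; apply: (hr (r / 2)) => //; rewrite /=; try lra.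
  by rewrite sub0r normrN gtr0_norm; lra.
Qed.

Lemma unif_cont_on_within (R : realType) (a b : R) (g : R -> R) :
  unif_cont_on a b g -> {within `[a, b], continuous g}.
Proof.
move=> gu; apply/subspace_continuousP => x; rewrite /= in_itv/= => xab.
apply/cvgrPdist_lt => e e0; have [d d0 hd] := gu e e0.
rewrite near_withinE; exists d => // y /= xy; rewrite in_itv/= => yab.
exact: hd.
Qed.

Lemma unif_cont_IVT {R : realType} {a b : R} {g : R -> R} (c d v : R) :
  unif_cont_on a b g -> a <= c -> c <= d -> d <= b ->
  g c <= v <= g d \/ g d <= v <= g c -> exists2 z, c <= z <= d & g z = v.
Proof.
move=> gu ac cd db gv.
have gc : {within `[c, d], continuous g}.
  apply: unif_cont_on_within => e e0; have [r r0 hr] := gu e e0.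
  by exists r => // x y xcd ycd; apply: hr; lra.
have [|z] := @IVT R g c d v cd gc; last by rewrite in_itv/=; exists z.
by rewrite ge_min le_max; case: gv => /andP[-> ->]; rewrite ?orbT.
Qed.

Lemma maps_itv_iter {R : realType} {a b : R} {g : R -> R} n :
  maps_itv a b g -> maps_itv a b (iter n g).
Proof. by move=> gm; elim: n => //= n IH x /IH /gm. Qed.

Lemma unif_cont_iter {R : realType} {a b : R} {g : R -> R} n :
  maps_itv a b g -> unif_cont_on a b g -> unif_cont_on a b (iter n g).
Proof.
move=> gm gu; elim: n => [|n IH] e e0; first by exists e.
have [d d0 hd] := gu e e0; have [r r0 hr] := IH d d0.
exists r => // x y xab yab xy; apply: hd; last exact: hr.
  exact: maps_itv_iter.
exact: maps_itv_iter.
Qed.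

Lemma horseshoe_iter {R : realType} (a b : R) (f : R -> R) k :
  horseshoe a b (iter k f) -> horseshoe a b f.
Proof.
move=> [p [q [s [t [n [m [h1 h2 h3 cJ cK]]]]]]].
exists p, q, s, t, (n * k)%N, (m * k)%N; split => // y yH.
  by have [z zJ zy] := cJ y yH; exists z => //; rewrite -iter_iter.
by have [z zJ zy] := cK y yH; exists z => //; rewrite -iter_iter.
Qed.

(** The conjugate of [g] by [x |-> - x], which exchanges left and right. *)
Definition mirror {R : realType} (g : R -> R) (x : R) : R := - g (- x).

Lemma iter_mirror {R : realType} (g : R -> R) n x :
  iter n (mirror g) x = - iter n g (- x).
Proof. by elim: n => [|n IH] /=; rewrite ?opprK // IH /mirror opprK. Qed.

Lemma covers_mirror {R : realType} (g : R -> R) n c d p t :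
  covers (iter n (mirror g)) c d p t ->
  covers (iter n g) (- d) (- c) (- t) (- p).
Proof.
move=> cov y yH; have [|z zcd] := cov (- y); first by apply/andP; split; lra.
by rewrite iter_mirror => /oppr_inj zy; exists (- z) => //; apply/andP; split; lra.
Qed.

Lemma horseshoe_mirror {R : realType} (a b : R) (g : R -> R) :
  horseshoe (- b) (- a) (mirror g) -> horseshoe a b g.
Proof.
move=> [p [q [s [t [n [m [[ap tb] [pq st] qs cJ cK]]]]]]].
exists (- t), (- s), (- q), (- p), m, n.
split; [split; lra|split; lra|lra|exact: covers_mirror|exact: covers_mirror].
Qed.

Lemma unif_cont_mirror {R : realType} {a b : R} {g : R -> R} :
  unif_cont_on a b g -> unif_cont_on (- b) (- a) (mirror g).
Proof.
move=> gu e e0; have [d d0 hd] := gu e e0; exists d => // x y xab yab xy.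
rewrite /mirror -opprD normrN; apply: hd; try (apply/andP; split; lra).
by rewrite -opprD normrN.
Qed.

(** The map [g] goes up from [x] over [l], down from [y] below [x], and up again
    at [l], so both [[x, y]] and [[y, l]] cover [[x, l]].  As [g y < x] is strict,
    the first interval can be cut at a point [w < y] with [g w = x], which makes
    the two disjoint. *)
Lemma outward_horseshoe {R : realType} {a b : R} {g : R -> R} (x y l : R) :
  unif_cont_on a b g -> a <= x -> l <= b ->
  x < y < l -> l <= g x -> g y < x -> l <= g l -> horseshoe a b g.
Proof.
move=> gu ax lb /andP[xy yl] gx gy gl.
have [||||w /andP[xw wy] gw] := unif_cont_IVT x y x gu; try lra.
have wy' : w < y.
  by rewrite lt_neqAle wy andbT; apply/eqP => wyE; move: gw; rewrite wyE; lra.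
exists x, w, y, l, 1%N, 1%N; split; [lra|lra|lra| |] => v /andP[xv vl] /=.
  by apply: (unif_cont_IVT _ _ _ gu); lra.
by apply: (unif_cont_IVT _ _ _ gu); lra.
Qed.

(** * Backward orbits accumulating at an invariant interval *)

Definition backward_orbit {R : realType} (a b : R) (g : R -> R)
    (u : nat -> R) : Prop :=
  forall n, a <= u n <= b /\ g (u n.+1) = u n.

(** Suppose that the backward orbit [u] starts to the right of [[l, r]] but has
    no point in some [(r, r + d)]; then it accumulates at [l] from the left.  Let
    [s] be the supremum of the points of [u] on the left that [g] maps to the
    right of [[l, r]].  Such points are mapped beyond [r + d], hence stay away
    from [l], and [s < l].  The first point [y] of [u] in [(s, l)] is mapped to
    the left of [l] by the choice of [s] and outside of [(s, l)] by minimality,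
    hence to some point [<= s]; while a point [x] slightly above [s] is still
    mapped above [l].  So [g] jumps as in [outward_horseshoe]. *)
Lemma faces_target_or_horseshoe {R : realType} {a b l r : R} {g : R -> R}
    {u : nat -> R} :
  unif_cont_on a b g -> a <= l -> l <= r -> r <= b -> l <= g l <= r ->
  backward_orbit a b g u ->
  (forall n, ~~ (l <= u n <= r)) ->
  (forall e : R, 0 < e -> exists n, l - e < u n < r + e) ->
  r < u 0%N ->
  (forall e : R, 0 < e -> exists n, r < u n < r + e) \/ horseshoe a b g.
Proof.
move=> gu al lr rb gl ub uout uacc u0.
have [|/existsNP [d /not_implyP [d0 /forallNP hd]]] :=
    pselect (forall e : R, 0 < e -> exists n, r < u n < r + e); first by left.
right.
have out n : u n < l \/ r + d <= u n.
  have /negP h1 := hd n; have h2 := uout n; lra.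
have [|eta eta0 geta] := gu (d / 2); first lra.
pose S := [set x | exists k, [/\ x = u k.+1, u k.+1 < l & r < u k]].
have Sl x : S x -> a <= x <= l - eta /\ r + d <= g x.
  move=> [k [-> ukl rk]]; have [uab _] := ub k.+1; have [_ guk] := ub k.
  have gur : r + d <= g (u k.+1) by rewrite guk; have := out k; lra.
  split=> //; apply/andP; split; first lra.
  rewrite leNgt; apply/negP => ltk.
  have := geta (u k.+1) l uab; rewrite ler0_norm; last lra.
  have := ler_norm (g (u k.+1) - g l); lra.
have S0 : S !=set0.
  (* The orbit has points on the left; the first one, in backward time, is in [S]. *)
  have [n hn] := uacc d d0.
  have : u n < l by have := out n; lra.
  elim: n {hn} => [|n IH] hn; first lra.
  have [/IH //|hrn] := out n.
  by exists (u n.+1), n; split => //; lra.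
have supS : has_sup S by split => //; exists (l - eta) => x /Sl; lra.
pose s := sup S.
have sl : s <= l - eta by apply: ge_sup => // x /Sl; lra.
have exK : exists n, s < u n < l.
  have [|n hn] := uacc (Num.min eta d); first by rewrite lt_min eta0.
  exists n; have := out n; move: hn; rewrite minEle; case: ifP; lra.
case: (ex_minnP exK) => -[|k]; first lra.
move=> /andP[sK Kl] minK.
have uks : u k <= s.
  rewrite leNgt; apply/negP => suk.
  have [ukl|ruk] := out k.
    by have := minK k; rewrite suk ukl ltnn => /(_ isT).
  have : u k.+1 <= s.
    by apply: ub_le_sup => //; [exact: supS.2|exists k; split => //; lra].
  lra.
(* A point of [S] within [eta / 2] of [s] transfers its image above [r + d] to [x]. *)
have [x0 Sx0 sx0] := @sup_adherent R S (eta / 2) (ltac:(lra)) supS.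
have x0s : x0 <= s by apply: ub_le_sup => //; exact: supS.2.
have [x0a gx0] := Sl _ Sx0.
pose x := s + Num.min (eta / 2) ((u k.+1 - s) / 2).
have [xs xe xK] : [/\ s < x, x <= s + eta / 2 & x < u k.+1].
  by rewrite /x minEle; case: ifP => ?; split; lra.
have gx : l <= g x.
  have := geta x0 x (ltac:(lra)) (ltac:(lra)); rewrite ler0_norm; last lra.
  have := ler_norm (g x0 - g x); rewrite -/s in sx0; lra.
have [_ guk] := ub k.
by apply: (outward_horseshoe x (u k.+1) l gu); lra.
Qed.

Lemma faces_target_or_horseshoe_left {R : realType} {a b l r : R} {g : R -> R}
    {u : nat -> R} :
  unif_cont_on a b g -> a <= l -> l <= r -> r <= b -> l <= g r <= r ->
  backward_orbit a b g u ->
  (forall n, ~~ (l <= u n <= r)) ->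
  (forall e : R, 0 < e -> exists n, l - e < u n < r + e) ->
  u 0%N < l ->
  (forall e : R, 0 < e -> exists n, l - e < u n < l) \/ horseshoe a b g.
Proof.
move=> gu al lr rb gr ub uout uacc u0.
have [] := @faces_target_or_horseshoe R (- b) (- a) (- r) (- l) (mirror g) (-%R \o u)
  (unif_cont_mirror gu); rewrite /mirror /= ?opprK; try lra.
- by move=> n /=; have [? gun] := ub n; rewrite opprK gun; split; lra.
- by move=> n /=; have := uout n; lra.
- by move=> e /uacc [n]; exists n; lra.
- by move=> h; left => e /h [n]; exists n; lra.
by right; exact: horseshoe_mirror.
Qed.

(** * Heteroclinic cycles of invariant intervals *)

Lemma backward_orbit_iter {R : realType} {a b : R} {g : R -> R} {u : nat -> R} n :
  backward_orbit a b g u -> iter n g (u n) = u 0%N.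
Proof. by move=> ub; elim: n => // n IH; rewrite iterSr (ub n).2. Qed.

(** Unless there is a horseshoe already, points on the side of each interval that
    faces its target reach the target, and it remains to find two facing ends.
    Intervals of the same colour [t] may overlap, so the choice needs care: take
    the largest right end [r x] of an interval with target on its right, then the
    smallest left end [l y > r x] of an interval with target on its left.
    Every interval that lies to the right of [r x] has its target on the left, so
    the target [x'] of [x] satisfies [l y <= l x'].  The target [z] of [y] ends at
    [r x] or before: by minimality of [l y] it could only end later by reaching
    across [r x], but then it contains points near [r x] whose orbits enter the
    other colour, although it has the colour of [x] and is invariant. *)
Lemma heteroclinic_horseshoe {R : realType} (a b : R) (g : R -> R)
    (X : finType) (x0 : X) (l r : X -> R) (t : X -> bool) :
  maps_itv a b g -> unif_cont_on a b g ->
  (forall x, [/\ a <= l x, l x <= r x & r x <= b]) ->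
  (forall x y, l x <= y <= r x -> l x <= g y <= r x) ->
  (forall x y z, l x <= z <= r x -> l y <= z <= r y -> t x = t y) ->
  (forall x, exists y u, [/\ t x != t y, backward_orbit a b g u,
     l y <= u 0%N <= r y &
     forall e : R, 0 < e -> exists n, l x - e < u n < r x + e]) ->
  horseshoe a b g.
Proof.
move=> gm gu itv inv sep het; apply: contrapT => nohs.
have inv_iter x y n : l x <= y <= r x -> l x <= iter n g y <= r x.
  by move=> xy; elim: n => //= n IH; exact: inv.
pose goesR x y := r x < l y /\ forall e : R, 0 < e -> exists v n,
  r x < v < r x + e /\ l y <= iter n g v <= r y.
pose goesL x y := r y < l x /\ forall e : R, 0 < e -> exists v n,
  l x - e < v < l x /\ l y <= iter n g v <= r y.
have RorL x : exists y, t x != t y /\ (goesR x y \/ goesL x y).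
  have [y [u [txy ub u0 uacc]]] := het x; exists y; split=> //.
  have [al lr rb] := itv x.
  have hit n : l y <= iter n g (u n) <= r y by rewrite (backward_orbit_iter n ub).
  have uout n : ~~ (l x <= u n <= r x).
    apply: contra txy => /(inv_iter x (u n) n) h; apply/eqP.
    exact: sep h (hit n).
  have := uout 0%N; rewrite negb_and -!ltNge => /orP[u0l|u0r].
    right; split.
      rewrite ltNge; apply: contra txy => lxry; apply/eqP.
      by apply: (sep x y (l x)); lra.
    have [h|//] := faces_target_or_horseshoe_left gu al lr rb
       (inv x (r x) (ltac:(lra))) ub uout uacc u0l.
    by move=> e /h [n hn]; exists (u n), n.
  left; split.
    rewrite ltNge; apply: contra txy => lxry; apply/eqP.
    by apply: (sep x y (r x)); lra.
  have [h|//] := faces_target_or_horseshoe gu al lr rb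
     (inv x (l x) (ltac:(lra))) ub uout uacc u0r.
  by move=> e /h [n hn]; exists (u n), n.
pose isR x := `[< exists y, t x != t y /\ goesR x y >].
pose isL x := `[< exists y, t x != t y /\ goesL x y >].
have notR_L x : ~~ isR x -> isL x.
  move=> /asboolPn nR; apply/asboolP; have [y [txy [h|h]]] := RorL x.
    by case: nR; exists y.
  by exists y.
have [x1 x1R] : exists x, isR x.
  case: (arg_minP l (isT : predT x0)) => x _ xmin; exists x.
  apply: contraT => /notR_L /asboolP [y [_ [yx _]]].
  by have := xmin y isT; have [_ ? _] := itv y; lra.
case: (arg_maxP r x1R) => x xR xmax.
have /asboolP [x' [txx' [xx' xgo]]] := xR.
have afterL y : r x < l y -> isL y.
  move=> xy; apply: notR_L; apply/negP => /xmax; have [_ h1 _] := itv y.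
  by move=> /= h2; lra.
pose nextL y := isL y && (r x < l y).
have x'L : nextL x' by rewrite /nextL afterL.
case: (arg_minP l x'L) => y /andP[yL xy] ymin.
have /asboolP [z [tyz [zy ygo]]] := yL.
have zx : r z <= r x.
  rewrite leNgt; apply/negP => xz.
  have lzrx : l z <= r x.
    rewrite leNgt; apply/negP => xz'.
    have := ymin z; rewrite /nextL afterL // xz' => /(_ isT).
    by have [_ ? _] := itv z; lra.
  have txz : t x = t z by apply: (sep x z (r x)); have [_ ? _] := itv x; lra.
  have [|v [n [vx vx']]] := xgo (r z - r x); first lra.
  case/negP: txx'; rewrite txz; apply/eqP; apply: (sep z x' (iter n g v)) => //.
  by apply: inv_iter; lra.
have [|v [n [vx vx']]] := xgo ((l y - r x) / 2); first lra.
have [|w [m [wy wz]]] := ygo ((l y - r x) / 2); first lra.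
have yx' : l y <= l x' by apply: ymin; rewrite /nextL afterL.
have [alx lrx rxb] := itv x; have [aly lry ryb] := itv y.
have [_ nx] := andP (inv_iter x (r x) n (ltac:(lra))).
have [my _] := andP (inv_iter y (l y) m (ltac:(lra))).
apply: nohs; exists (r x), v, w, (l y), n, m.
split; [lra|lra|lra| |] => c hc.
  by apply: (unif_cont_IVT _ _ _ (unif_cont_iter n gm gu)); lra.
by apply: (unif_cont_IVT _ _ _ (unif_cont_iter m gm gu)); lra.
Qed.

(** * From limits of backward branches to backward orbits *)

Lemma iter_induced_map (T : Type) (f : T -> T) n (B : set T) :
  iter n (induced_map f) B = iter n f @` B.
Proof.
elim: n => [|n IH] /=; first by rewrite image_id.
by rewrite IH /induced_map image_comp.
Qed.

Lemma set_orbit_iter (T : Type) (f : T -> T) (B : set T) x k :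
  set_orbit f B x -> set_orbit f B (iter k f x).
Proof.
move=> [n _ xn]; exists (k + n)%N => //; rewrite iterD iter_induced_map.
by exists x.
Qed.

Lemma iter_period_mul (T : Type) (F : T -> T) (x : T) p k :
  iter p F x = x -> iter (k * p) F x = x.
Proof. by move=> px; elim: k => // k IH; rewrite mulSn iterD IH. Qed.

Lemma set_orbit_periodic {T : Type} {f : T -> T} {B : set T} {p x} :
  (0 < p)%N -> iter p (induced_map f) B = B -> set_orbit f B x ->
  exists2 i, (i < p)%N & iter i (induced_map f) B x.
Proof.
move=> p0 pB [n _ xn]; exists (n %% p)%N; first by rewrite ltn_mod.
by move: xn; rewrite {1}(divn_eq n p) addnC iterD iter_period_mul.
Qed.

(** The sup and inf in [hausdorff_dist] are those of nonempty bounded sets, since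
    both sets lie in [[a, b]]. *)
Lemma hausdorff_dist_lt {R : realType} {a b e : R} {A B : set R} :
  subcontinua `[a, b] A -> subcontinua `[a, b] B -> hausdorff_dist A B < e ->
  (forall x, A x -> exists2 y, B y & `|x - y| < e) /\
  (forall y, B y -> exists2 x, A x & `|x - y| < e).
Proof.
move=> [[x0 Ax0] _ _ AI] [[y0 By0] _ _ BI]; rewrite /hausdorff_dist gt_max.
have Ib x : `[a, b]%classic x -> a <= x <= b by rewrite /= in_itv.
have bd x y : A x -> B y -> `|x - y| <= b - a.
  move=> /AI /Ib xab /BI /Ib yab; rewrite ler_norml; lra.
have lbd (S : set R) (h : R -> R) : has_lbound [set `|h z| | z in S].
  by exists 0 => _ [z _ <-].
move=> /andP[hA hB]; split => [x Ax|y By].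
  have [||_ [y By <-] h] := @inf_lt R [set `|x - y| | y in B] e.
  - by exists `|x - y0|; exists y0.
  - apply: le_lt_trans hA; apply: ub_le_sup; last by exists x.
    exists (b - a) => _ [x' Ax' <-]; apply: le_trans (bd _ _ Ax' By0).
    by apply: (ge_inf (lbd B (fun y => x' - y))); exists y0.
  - by exists y.
have [||_ [x Ax <-] h] := @inf_lt R [set `|x - y| | x in A] e.
- by exists `|x0 - y|; exists x0.
- apply: le_lt_trans hB; apply: ub_le_sup; last by exists y.
  exists (b - a) => _ [y' By' <-]; apply: le_trans (bd _ _ Ax0 By').
  by apply: (ge_inf (lbd A (fun x => x - y'))); exists x0.
- by exists x.
Qed.

Lemma subcontinuum_itv {R : realType} {a b : R} {A : set R} :
  subcontinua `[a, b] A ->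
  exists l r, [/\ a <= l, l <= r, r <= b & A = `[l, r]%classic].
Proof.
move=> [A0 Ac /connected_intervalP Aitv AI].
have idc : {within A, continuous (@id R)}.
  by apply: continuous_subspaceT => x; exact: cvg_id.
have [r Ar rmax] := compact_EVT_max A0 Ac idc.
have [l Al lmin] := compact_EVT_min A0 Ac idc.
exists l, r.
have := AI _ (set_mem Al); have := AI _ (set_mem Ar); rewrite /= !in_itv/=.
move=> /andP[ar rb] /andP[al lb]; split => //; first exact: lmin.
apply/seteqP; split => x; rewrite /= in_itv/=.
  by move=> Ax; rewrite lmin ?rmax// inE.
by move=> lxr; apply: Aitv lxr; exact: set_mem.
Qed.

Lemma subcontinua_iter (R : realType) (a b : R) (f : R -> R) (B : set R) n :
  maps_itv a b f -> unif_cont_on a b f -> subcontinua `[a, b] B ->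
  subcontinua `[a, b] (iter n (induced_map f) B).
Proof.
move=> fm fu [[x Bx] Bc Bconn BI]; rewrite iter_induced_map.
have fc : {within B, continuous (iter n f)}.
  apply: continuous_subspaceW BI _; apply: unif_cont_on_within.
  exact: unif_cont_iter.
split.
- by exists (iter n f x); exists x.
- exact: continuous_compact.
- exact: connected_continuous_connected.
- move=> _ [y /BI yI <-]; move: yI; rewrite /= !in_itv/=.
  exact: maps_itv_iter.
Qed.

Lemma branch_orbit {R : realType} {I : set R} {f : R -> R} {A : set R}
    {As : nat -> set R} {x : R} :
  backward_branch I f A As -> A x ->
  exists y : nat -> R, [/\ y 0%N = x, forall n, As n (y n) &
                           forall n, f (y n.+1) = y n].
Proof.
move=> [_ As0 Asf] Ax.
have /choice [sel selP] (nz : nat * R) : exists w, As nz.1 nz.2 ->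
    As nz.1.+1 w /\ f w = nz.2.
  case: (pselect (As nz.1 nz.2)) => [|nA]; last by exists 0.
  by rewrite -[X in X _ -> _]Asf => -[w Asw fw]; exists w.
pose y := fix y n := if n is n'.+1 then sel (n', y n') else x.
have yA n : As n (y n).
  by elim: n => [|n IH] /=; [rewrite As0|have [] := selP (n, y n) IH].
by exists y; split => // n; have [] := selP (n, y n) (yA n).
Qed.

(** As [B] has interior, some interval [A_n] of the branch is so close to [B] that
    it contains the midpoint of [B]; the [n]-th image of the midpoint is in [A]. *)
Lemma branch_limit_meets {R : realType} {a b : R} {f : R -> R} {A B : set R} :
  nondegenerate_set B -> special_alpha_limit `[a, b] f A B ->
  exists2 x, A x & set_orbit f B x.
Proof.
move=> [x1 [x2 [Bx1 Bx2 x12]]] [Bc [As [[Asc As0 Asf] [k _ kB]]]].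
have [l [r [al lr rb BE]]] := subcontinuum_itv Bc.
have ltlr : l < r.
  move: Bx1 Bx2; rewrite BE /= !in_itv/= => h1 h2.
  rewrite lt_neqAle lr andbT; apply/eqP => lrE; apply: x12; lra.
have lr20 : 0 < (r - l) / 2 by lra.
move/cvgrPdist_lt: kB => /(_ _ lr20) [N _ /(_ N (leqnn N))].
rewrite sub0r normrN => /(le_lt_trans (ler_norm _)) hN.
have [_ near] := hausdorff_dist_lt (Asc _) Bc hN.
have [|z1 Az1 z1l] := near l; first by rewrite BE /= in_itv/= lexx.
have [|z2 Az2 z2r] := near r; first by rewrite BE /= in_itv/= lexx lr.
have [_ _ /connected_intervalP Aitv _] := Asc (k N).
pose m := (l + r) / 2.
have Am : As (k N) m.
  apply: (Aitv _ _ Az1 Az2); move: z1l z2r; rewrite /m !ltr_norml; lra.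
have Bm : B m by rewrite BE /= in_itv/= /m; lra.
exists (iter (k N) f m); last first.
  by apply: set_orbit_iter; exists 0%N.
rewrite -As0; elim: (k N) (m) Am => //= n IH z Az.
by rewrite -iterS iterSr; apply: IH; rewrite -Asf; exists z.
Qed.

(** Otherwise every residue mod [p] fails for some positive [e], and then all
    residues fail for the minimum of these finitely many values. *)
Lemma pigeonhole_accumulation {R : realType} (P : nat -> R -> Prop) (p : nat) :
  (0 < p)%N -> (forall n e e', e <= e' -> P n e -> P n e') ->
  (forall e, 0 < e -> exists n, P n e) ->
  exists2 i, (i < p)%N & forall e : R, 0 < e -> exists n, P (n * p + i)%N e.
Proof.
move=> p0 Pmono Pex; apply: contrapT => none.
have /choice [eps epsP] (i : 'I_p) : exists e : R,
    0 < e /\ forall n, ~ P (n * p + i)%N e.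
  apply: contrapT => /forallNP noe; apply: none; exists i => // e e0.
  by apply: contrapT => /forallNP nP; apply: (noe e).
pose e := \big[Num.min/(1 : R)]_(i < p) eps i.
have e0 : 0 < e by rewrite lt_bigmin // => i _; exact: (epsP i).1.
have [n Pn] := Pex e e0.
apply: ((epsP (Ordinal (ltn_pmod n p0))).2 (n %/ p)%N).
by rewrite /= -divn_eq; apply: Pmono Pn; exact: bigmin_le.
Qed.

(** Pull [x] back along the branch to a backward [f]-orbit [y] accumulating at
    [B], and keep the times congruent to some [j < p] along which it does.  Its
    image under [f^i] is a backward orbit of [f^p] accumulating at [f^i(B)].  The
    image under [f^(i + p)] is used instead: since [i + p >= j], the starting point
    is then a forward image of [x], while [f^p(B) = B]. *)
Lemma limit_backward_orbit {R : realType} {a b : R} {f : R -> R}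
    {A B Q : set R} {p : nat} {x : R} (i : nat) :
  maps_itv a b f -> unif_cont_on a b f -> (0 < p)%N ->
  iter p (induced_map f) B = B -> special_alpha_limit `[a, b] f A B ->
  A x -> set_orbit f Q x ->
  exists u : nat -> R, [/\ backward_orbit a b (iter p f) u,
    set_orbit f Q (u 0%N) &
    forall e : R, 0 < e -> exists n, exists2 c,
      iter i (induced_map f) B c & `|u n - c| < e].
Proof.
move=> fm fu p0 pB [Bc [As [Asb [k _ kB]]]] Ax Qx.
have [y [y0 yA yf]] := branch_orbit Asb Ax.
have [Asc _ _] := Asb.
have Ib (S : set R) z : subcontinua `[a, b] S -> S z -> a <= z <= b.
  by move=> [_ _ _ SI] /SI; rewrite /= in_itv.
have yab n : a <= y n <= b by exact: Ib (Asc n) (yA n).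
have ybn n m : iter n f (y (n + m)%N) = y m.
  by elim: n => // n IH; rewrite iterSr addSn yf.
have [j jp yacc] : exists2 j, (j < p)%N & forall e : R, 0 < e ->
    exists n, exists2 c, B c & `|y (n * p + j)%N - c| < e.
  apply: (pigeonhole_accumulation (fun n e => exists2 c, B c & `|y n - c| < e)) => //.
    by move=> n e e' ee' [c Bc' yc]; exists c => //; exact: lt_le_trans ee'.
  move=> e e0; move/cvgrPdist_lt: kB => /(_ _ e0) [N _ /(_ N (leqnn N))].
  rewrite sub0r normrN => /(le_lt_trans (ler_norm _)) hN.
  have [near _] := hausdorff_dist_lt (Asc _) Bc hN.
  by exists (k N); exact: near.
exists (fun n => iter (i + p) f (y (n * p + j)%N)); split.
- move=> n; split; first exact: maps_itv_iter.
  have commute z : iter p f (iter (i + p) f z) = iter (i + p) f (iter p f z).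
    by rewrite -!iterD addnC.
  by rewrite /= commute mulSn -(addnA p) (ybn p).
- rewrite mul0n add0n -(subnK (leq_trans (ltnW jp) (leq_addl i p))) iterD.
  have -> : iter j f (y j) = x by rewrite -y0 -{2}(addn0 j) ybn.
  exact: set_orbit_iter.
- move=> e e0; have [d d0 hd] := unif_cont_iter (i + p) fm fu e e0.
  have [n [c Bc' yc]] := yacc d d0; exists n, (iter (i + p) f c).
    rewrite -{1}pB -iterD iter_induced_map; by exists c.
  by apply: hd => //; exact: Ib Bc Bc'.
Qed.

Theorem theorem1p3 (R : realType) (a b : R) (f : R -> R) (A B C : set R)
  (le_ab : a <= b)
  (f_continuous : {within `[a, b], continuous f})
  (f_maps : set_fun `[a, b] `[a, b] f)
  (A_subcontinuum : subcontinua `[a, b] A)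
  (B_nondegenerate : nondegenerate_set B)
  (C_nondegenerate : nondegenerate_set C)
  (B_limit : (induced_periodic `[a, b] f `&` special_alpha_limit `[a, b] f A) B)
  (C_limit : (induced_periodic `[a, b] f `&` special_alpha_limit `[a, b] f A) C)
  (orbits_disjoint : set_orbit f B `&` set_orbit f C = set0) :
  (0 < topological_entropy `[a, b] f)%E.
Proof.
apply: horseshoe_entropy.
have fu := within_unif_cont_on f_continuous.
have fm : maps_itv a b f.
  by move=> x xab; have := f_maps x; rewrite /= !in_itv/=; apply.
have [[Bc [pB pB0 perB]] Blim] := B_limit.
have [[Cc [pC pC0 perC]] Clim] := C_limit.
pose p := (pC * pB)%N.
have p0 : (0 < p)%N by rewrite muln_gt0 pC0.
have pBB : iter p (induced_map f) B = B by exact: iter_period_mul.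
have pCC : iter p (induced_map f) C = C by rewrite /p mulnC; exact: iter_period_mul.
have [xB AxB BxB] := branch_limit_meets B_nondegenerate Blim.
have [xC AxC CxC] := branch_limit_meets C_nondegenerate Clim.
(* The colour [true] stands for the orbit of [B], [false] for that of [C]. *)
pose side (t : bool) := if t then B else C.
pose D (x : 'I_p * bool) := iter x.1 (induced_map f) (side x.2).
have perD x : iter p (induced_map f) (D x) = D x.
  by rewrite /D -iterD addnC iterD /side; case: x.2; rewrite ?pBB ?pCC.
have Dc x : subcontinua `[a, b] (D x).
  by apply: subcontinua_iter => //; rewrite /side; case: x.2.
have /choice [lr lrP] x : exists lr : R * R,
    [/\ a <= lr.1, lr.1 <= lr.2, lr.2 <= b & D x = `[lr.1, lr.2]%classic].
  by have [l [r h]] := subcontinuum_itv (Dc x); exists (l, r).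
have inD x z : (lr x).1 <= z <= (lr x).2 <-> D x z.
  by have [_ _ _ ->] := lrP x; rewrite /= in_itv.
apply: (horseshoe_iter _ _ _ p).
apply: (heteroclinic_horseshoe a b (iter p f) _ (Ordinal p0, true)
  (fun x => (lr x).1) (fun x => (lr x).2) snd) => /=.
- exact: maps_itv_iter.
- exact: unif_cont_iter.
- by move=> x; have [] := lrP x.
- move=> x z /inD Dz; apply/inD.
  by rewrite -perD iter_induced_map; exists z.
- move=> x y z /inD Dxz /inD Dyz.
  have orb w : D w z -> set_orbit f (side w.2) z by exists w.1.
  move: (orb _ Dxz) (orb _ Dyz); rewrite /side.
  have no : ~ (set_orbit f B z /\ set_orbit f C z).
    move=> h; have : (set_orbit f B `&` set_orbit f C) z by [].
    by rewrite orbits_disjoint.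
  by case: x.2; case: y.2 => // h1 h2; case: no.
- move=> x.
  have sideP t : iter p (induced_map f) (side t) = side t /\
      special_alpha_limit `[a, b] f A (side t).
    by rewrite /side; case: t.
  have [z Az Qz] : exists2 z, A z & set_orbit f (side (~~ x.2)) z.
    by rewrite /side; case: x.2; [exists xC|exists xB].
  have [u [ub u0 uacc]] := limit_backward_orbit x.1 fm fu p0
    (sideP x.2).1 (sideP x.2).2 Az Qz.
  have [j jp Dj] := set_orbit_periodic p0 (sideP _).1 u0.
  exists (Ordinal jp, ~~ x.2), u; split => //=.
  + by case: x.2.
  + exact/inD.
  + move=> e /uacc [n [c /inD Dc' uc]]; exists n.
    by move: uc; rewrite ltr_norml; lra.
Qed.
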